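(* Let $K:\mathbb{N}\to\mathbb{N}$ be any nondecreasing function satisfying $K(n)\ge n$ for every $n$. For any nonexpansive linear operator $T$ on a Hilbert space, any nonzero $f$ in the space and any $\varepsilon>0$, let $r_K(f,\varepsilon)$ be the least $n\ge1$ such that $\|A_mf-A_nf\|\le\varepsilon$ for every $m\in[n,K(n)]$, and let $\rho=\lceil\|f\|/\varepsilon\rceil$. Then: <br>(1) If $K(n)=n^{O(1)}$, then $r_K(f,\varepsilon)=2^{2^{O(\rho^2\log\log\rho)}}$. <br>(2) If $K(n)=2^{O(n)}$, then $r_K(f,\varepsilon)=2^{1}_{O(\rho^2)}$. <br>(3) If $K(n)=O(n)$ and $T$ is an isometry, then $r_K(f,\varepsilon)=2^{O(\rho^2\log\rho)}$.
   Context: A linear operator $T$ is nonexpansive if $\|Tf\|\le\|f\|$ for all $f$. For an integer $n\ge1$, $A_nf=\frac1n\sum_{0\le i<n}T^if$. The interval $[n,K(n)]$ is an interval of integers. $2^x_n$ denotes the $n$th iterate of the map $y\mapsto2^y$ starting with $x$ (so $2^1_{n}$ is a tower of $n$ twos). The conclusions are asymptotic upper bounds as $\rho\to\infty$, with implied constants depending only on $K$: for example (1) means that there are constants $C,\rho_0$, depending only on $K$, such that $r_K(f,\varepsilon)\le 2^{2^{C\rho^2\log\log\rho}}$ for all Hilbert spaces, all nonexpansive $T$, all nonzero $f$ and all $\varepsilon>0$ with $\rho\ge\rho_0$; (2) means $r_K(f,\varepsilon)\le 2^1_{\lceil C\rho^2\rceil}$, and (3) means $r_K(f,\varepsilon)\le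 2^{C\rho^2\log\rho}$, in the same sense. *)

(* Defs.v *)
From HB Require Import structures.
From mathcomp Require Import all_boot all_order all_algebra complex.
From mathcomp Require Import all_classical all_reals all_analysis.

Set Implicit Arguments.
Unset Strict Implicit.
Unset Printing Implicit Defensive.

Import Order.TTheory GRing.Theory Num.Theory.
Import numFieldNormedType.Exports.

Local Open Scope ring_scope.

(* [theta] is the conjugation of the scalar field; the inner product is linear
   on the left, theta-linear on the right, hermitian and positive definite. *)
Record hilbertSpace (F : numFieldType) (theta : F -> F) := HilbertSpace {
  hilbert_sort :> completeNormedModType F;
  inner : {dot hilbert_sort for theta};
  inner_normE : forall v : hilbert_sort, `|v| ^+ 2 = inner v v
}.

Definition realHilbert (R : realType) := @hilbertSpace R idfun.
Definition complexHilbert (R : realType) := @hilbertSpace R[i] Num.conj.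

(* The library norm of a complex space takes its values in R[i]. *)
Definition real_norm (R : realType) (H : realHilbert R) (v : H) : R := `|v|.
Definition complex_norm (R : realType) (H : complexHilbert R) (v : H) : R :=
  complex.Re `|v|.

Section Averages.
Variables (R : realType) (F : numFieldType) (V : lmodType F) (nrm : V -> R).
Implicit Types (T : V -> V) (f : V) (eps : R) (K : nat -> nat).

Definition ergodic_avg T (n : nat) f : V :=
  (n%:R)^-1 *: \sum_(0 <= i < n) iter i T f.

Definition stable_from K T f eps (n : nat) : Prop :=
  (1 <= n)%N /\
  forall m : nat, (n <= m <= K n)%N ->
    nrm (ergodic_avg T m f - ergodic_avg T n f) <= eps.

(* r = r_K(f, eps) *)
Definition is_stability_rate K T f eps (r : nat) : Prop :=
  stable_from K T f eps r /\
  forall n : nat, stable_from K T f eps n -> (r <= n)%N.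

Definition norm_ratio f eps : nat := `|Num.ceil (nrm f / eps)|%N.

(* r_K(f, eps) exists for all f and eps, and is at most B rho once
   rho >= rho0. *)
Definition rate_bounded K T (B : nat -> nat -> Prop) (rho0 : nat) : Prop :=
  forall f eps, f != 0 -> 0 < eps ->
    exists r : nat, is_stability_rate K T f eps r /\
      ((rho0 <= norm_ratio f eps)%N -> B (norm_ratio f eps) r).

End Averages.

Definition nonexpansive (R : realType) (V : Type) (nrm : V -> R) (T : V -> V) :
  Prop := forall f, nrm (T f) <= nrm f.

Definition norm_preserving (R : realType) (V : Type) (nrm : V -> R)
  (T : V -> V) : Prop := forall f, nrm (T f) = nrm f.

(* [B C rho r] reads "r is at most the bound with constant C at rho"; C and
   rho0 are chosen before the space, the operator, f and eps. *)
Definition uniform_rate (R : realType) (K : nat -> nat)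
    (P : forall V : Type, (V -> R) -> (V -> V) -> Prop)
    (B : R -> nat -> nat -> Prop) : Prop :=
  exists (C : R) (rho0 : nat), 0 < C /\
    (forall (H : realHilbert R) (T : {linear H -> H}),
       P H (@real_norm R H) T -> rate_bounded (@real_norm R H) K T (B C) rho0) /\
    (forall (H : complexHilbert R) (T : {linear H -> H}),
       P H (@complex_norm R H) T ->
       rate_bounded (@complex_norm R H) K T (B C) rho0).

(* 2^x_n in the paper's notation *)
Definition iter_exp2 (x n : nat) : nat := iter n (fun y => 2 ^ y)%N x.

Definition double_exp_bound (R : realType) (C : R) (rho r : nat) : Prop :=
  r%:R <= 2 `^ (2 `^ (C * rho%:R ^+ 2 * ln (ln rho%:R))) :> R.

Definition tower_bound (R : realType) (C : R) (rho r : nat) : Prop :=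
  (r <= iter_exp2 1 `|Num.ceil (C * rho%:R ^+ 2)|)%N.

Definition exp_bound (R : realType) (C : R) (rho r : nat) : Prop :=
  r%:R <= 2 `^ (C * rho%:R ^+ 2 * ln rho%:R) :> R.

(* Main.v *)
Require Import Defs.
From HB Require Import structures.
From mathcomp Require Import all_boot all_order all_algebra complex.
From mathcomp Require Import all_classical all_reals all_analysis.
From mathcomp Require Import zify lra ring.

Set Implicit Arguments.
Unset Strict Implicit.
Unset Printing Implicit Defensive.

Import Order.TTheory GRing.Theory Num.Theory.
Import numFieldNormedType.Exports.

Local Open Scope classical_set_scope.
Local Open Scope ring_scope.

(** The proof is an energy decrement. Write A_n f for the n-th ergodic average.
Averaging at a scale N much larger than m forgets an earlier averaging at
scale m: telescoping gives |A_N f - A_N (A_m f)| <= (2m/N) |f| ([avg_avg]).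
Hence |A_N f| is at most |A_m f|, up to an error of order |f| m/N, and more
generally at most the norm of any mean of averages taken at scales up to m
([energy_mono], [energy_midpoint]).

Suppose that n <= m and |A_m f - A_n f| > eps. By the parallelogram law the
square norm of the midpoint of A_m f and A_n f falls short of the average of
|A_m f|^2 and |A_n f|^2 by more than eps^2/4, and A_N f inherits this gain for
N much larger than m. So each unstable window [n, K(n)] makes the energy
|A_N f|^2 drop by about eps^2/4 between a scale far below n and a scale far
above K(n) ([energy_decrement]). With L = 128 rho^2 as the ratio between
consecutive scales the errors use up at most half of this drop. The energy
starts at most at |f|^2 <= rho^2 eps^2 and stays nonnegative, so 8 rho^2 + 1
consecutive unstable windows are impossible, and r_K(f, eps) is at most
the (8 rho^2 + 1)-st iterate of n |-> L K(L n), from any positive starting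
point ([stability_rate_search]).

The iteration is started at rho itself, so that the current scale x always
dominates L <= x^3 and every constant depending on K. One step then sends x
to at most x^d when K is polynomial, to at most four iterated exponentials of x
when K is exponential, and to at most rho^7 x when K is linear; iterating
8 rho^2 + 1 times gives the three bounds ([search_poly], [search_exp],
[search_linear]). *)

(** * Averages of a nonexpansive map *)

(** The properties of a Hilbert norm that the argument uses, for a norm with
values in R: this covers real and complex scalars at once. Homogeneity is
asked only for the factors 1/n of the averages; n = 0 gives that the norm of 0
is 0, since 0^-1 = 0. *)
Record euclidean_norm (R : realType) (F : numFieldType) (V : lmodType F)
    (nrm : V -> R) : Prop := EuclideanNorm {
  nrm_ge0 : forall u, 0 <= nrm u;
  nrm_eq0 : forall u, nrm u = 0 -> u = 0;
  nrmD : forall u v, nrm (u + v) <= nrm u + nrm v;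
  nrm_invn : forall n u, nrm (n%:R^-1 *: u) = n%:R^-1 * nrm u;
  nrm_parallelogram : forall u v,
    nrm (u + v) ^+ 2 + nrm (u - v) ^+ 2 = 2 * nrm u ^+ 2 + 2 * nrm v ^+ 2
}.

Section NonexpansiveAverages.
Variables (R : realType) (F : numFieldType) (V : lmodType F) (nrm : V -> R).
Variables (nrmP : euclidean_norm nrm) (T : {linear V -> V}).
Hypothesis T_nonexp : nonexpansive nrm T.
Implicit Types (f g u v : V) (i n m N L x : nat) (eps : R).

Local Notation A := (ergodic_avg T).

Lemma nrm0 : nrm 0 = 0.
Proof. by have := nrm_invn nrmP 0%N 0; rewrite scaler0 invr0 mul0r. Qed.

Lemma nrmN u : nrm (- u) = nrm u.
Proof.
have := nrm_parallelogram nrmP 0 u; rewrite add0r sub0r nrm0 => h.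
by apply/eqP; rewrite -(eqrXn2 (n := 2)) ?(nrm_ge0 nrmP) //; apply/eqP; lra.
Qed.

Lemma nrmB u v : nrm (u - v) <= nrm u + nrm v.
Proof. by rewrite -(nrmN v); exact: nrmD. Qed.

Lemma nrm_sum_le (G : nat -> V) (b : R) n :
  (forall i, (i < n)%N -> nrm (G i) <= b) ->
  nrm (\sum_(0 <= i < n) G i) <= n%:R * b.
Proof.
elim: n => [|n IHn] hG; first by rewrite big_geq // nrm0 mul0r.
rewrite big_nat_recr //= -natr1 mulrDl mul1r.
apply: le_trans (nrmD nrmP _ _) _; apply: lerD; last exact: hG.
by apply: IHn => i /ltnW; apply: hG.
Qed.

Lemma nrm_mean_le (G : nat -> V) (b : R) n : 0 <= b ->
  (forall i, (i < n)%N -> nrm (G i) <= b) ->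
  nrm (n%:R^-1 *: \sum_(0 <= i < n) G i) <= b.
Proof.
case: n => [|n] b0 hG; first by rewrite invr0 scale0r nrm0.
by rewrite (nrm_invn nrmP) ler_pdivrMl ?ltr0n //; exact: nrm_sum_le.
Qed.

Lemma nrm_iter i f : nrm (iter i T f) <= nrm f.
Proof. by elim: i => //= i; apply: le_trans; exact: T_nonexp. Qed.

Lemma nrm_avg n f : nrm (A n f) <= nrm f.
Proof.
by apply: nrm_mean_le => [|i _]; [exact: nrm_ge0|exact: nrm_iter].
Qed.

Lemma iter_linear i : linear (iter i T).
Proof. by elim: i => [//|i IHi] a u v; rewrite !iterS IHi linearP. Qed.

Lemma avg_linear n : linear (A n).
Proof.
move=> a u v; rewrite /ergodic_avg.
under eq_bigr do rewrite iter_linear.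
by rewrite big_split /= -scaler_sumr scalerDr !scalerA mulrC.
Qed.

HB.instance Definition _ n :=
  GRing.isLinear.Build F V V *:%R (ergodic_avg T n) (@avg_linear n).

Lemma avg_shift N g : nrm (A N g - A N (T g)) <= N%:R^-1 * (2 * nrm g).
Proof.
rewrite -scalerBr (nrm_invn nrmP); apply: ler_wpM2l; first by rewrite invr_ge0.
suff -> : \sum_(0 <= i < N) iter i T g - \sum_(0 <= i < N) iter i T (T g)
    = g - iter N T g.
  by apply: le_trans (nrmB _ _) _; have := nrm_iter N g; lra.
under [X in _ - X]eq_bigr do rewrite -iterSr.
rewrite -sumrB; elim: N => [|N IHN]; first by rewrite big_geq // subrr.
by rewrite big_nat_recr //= IHN addrA subrK.
Qed.

Lemma avg_shift_iter N i f :
  nrm (A N f - A N (iter i T f)) <= i%:R * (N%:R^-1 * (2 * nrm f)).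
Proof.
elim: i => [|i IHi]; first by rewrite subrr nrm0 mul0r.
rewrite -(subrKA (A N (iter i T f))) -natr1 mulrDl mul1r.
apply: le_trans (nrmD nrmP _ _) (lerD IHi _).
apply: le_trans (avg_shift _ _) _; apply: ler_wpM2l; first by rewrite invr_ge0.
by apply: ler_wpM2l => //; exact: nrm_iter.
Qed.

(** A_N (A_n f) is the mean of the A_N (T^i f) for i < n, each of which differs
from A_N f only by the boundary terms of the telescoping. *)
Lemma avg_avg N n f : (0 < n)%N ->
  nrm (A N f - A N (A n f)) <= n%:R * (N%:R^-1 * (2 * nrm f)).
Proof.
move=> n0; have nz : n%:R != 0 :> F by rewrite pnatr_eq0 -lt0n.
have b0 : 0 <= N%:R^-1 * (2 * nrm f).
  by rewrite !mulr_ge0 ?invr_ge0 // (nrm_ge0 nrmP).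
have -> : A N f - A N (A n f)
    = n%:R^-1 *: \sum_(0 <= i < n) (A N f - A N (iter i T f)).
  rewrite sumrB sumr_const_nat subn0 scalerBr -(scaler_nat n (A N f)).
  by rewrite scalerA mulVf // scale1r -linear_sum -linearZ.
apply: nrm_mean_le => [|i i_lt]; first by rewrite mulr_ge0.
by apply: le_trans (avg_shift_iter _ _ _) _; rewrite ler_wpM2r // ler_nat ltnW.
Qed.

(** Squaring |A_N f| <= |g| + (2/L) |f|: as |g| <= |f| and L >= 1, the terms
(4/L) |g| |f| and (4/L^2) |f|^2 add up to at most (8/L) |f|^2. *)
Lemma energy_le L m N f g : (0 < m)%N -> (0 < L)%N -> (L * m <= N)%N ->
  nrm g <= nrm f -> nrm (A N f - A N g) <= m%:R * (N%:R^-1 * (2 * nrm f)) ->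
  nrm (A N f) ^+ 2 <= nrm g ^+ 2 + 8 / L%:R * nrm f ^+ 2.
Proof.
move=> m0 L0 LmN gf hA.
have g0 := nrm_ge0 nrmP g.
have LR : 1 <= L%:R :> R by rewrite ler1n.
have NR : 0 < N%:R :> R by rewrite ltr0n; nia.
have mN : m%:R / N%:R <= L%:R^-1 :> R.
  by rewrite ler_pdivrMr // ler_pdivlMl ?ltr0n // -natrM ler_nat.
have iL1 : L%:R^-1 <= 1 :> R by rewrite invf_le1 ?ltr0n.
have iL0 : 0 <= L%:R^-1 :> R by rewrite invr_ge0 ler0n.
have h : nrm (A N f) <= nrm g + 2 * L%:R^-1 * nrm f.
  rewrite -{1}(subrK (A N g) (A N f)).
  apply: le_trans (nrmD nrmP _ _) _; rewrite addrC.
  apply: lerD; first exact: nrm_avg.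
  apply: le_trans hA _.
  have -> : m%:R * (N%:R^-1 * (2 * nrm f)) = (m%:R / N%:R) * (2 * nrm f) :> R.
    by rewrite !mulrA.
  have : 0 <= 2 * nrm f by rewrite mulr_ge0 // (nrm_ge0 nrmP).
  by move/ler_wpM2l => /(_ _ _ mN); rewrite mulrC; lra.
have h2 : nrm (A N f) ^+ 2 <= (nrm g + 2 * L%:R^-1 * nrm f) ^+ 2.
  have := nrm_ge0 nrmP (A N f).
  by move=> h0; rewrite lerXn2r // nnegrE (le_trans h0).
apply: le_trans h2 _; move: iL0 iL1; set t := L%:R^-1 => t0 t1.
set a := nrm g in g0 gf *; set b := nrm f in gf *.
have b0 : 0 <= b by exact: le_trans gf.
have h3 : t * (a * b) <= t * (b * b) by rewrite ler_wpM2l // ler_wpM2r.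
have h4 : t * (t * (b * b)) <= t * (b * b).
  by rewrite ler_piMl // !mulr_ge0.
have -> : (a + 2 * t * b) ^+ 2
    = a ^+ 2 + 4 * (t * (a * b)) + 4 * (t * (t * (b * b))).
  by ring.
have -> : a ^+ 2 + 8 * t * b ^+ 2
    = a ^+ 2 + 4 * (t * (b * b)) + 4 * (t * (b * b)).
  by ring.
lra.
Qed.

Lemma energy_mono L m N f : (0 < m)%N -> (0 < L)%N -> (L * m <= N)%N ->
  nrm (A N f) ^+ 2 <= nrm (A m f) ^+ 2 + 8 / L%:R * nrm f ^+ 2.
Proof.
by move=> m0 L0 LmN; apply: energy_le LmN (nrm_avg _ _) (avg_avg _ _ _).
Qed.

Lemma energy_midpoint L m n N f : (0 < n <= m)%N -> (0 < L)%N ->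
  (L * m <= N)%N ->
  nrm (A N f) ^+ 2 <=
    nrm (2%:R^-1 *: (A m f + A n f)) ^+ 2 + 8 / L%:R * nrm f ^+ 2.
Proof.
move=> /andP[n0 nm] L0 LmN; have m0 : (0 < m)%N by exact: leq_trans nm.
apply: (energy_le m0 L0 LmN).
  rewrite (nrm_invn nrmP) ler_pdivrMl //.
  apply: le_trans (nrmD nrmP _ _) _.
  by have := nrm_avg m f; have := nrm_avg n f; lra.
have z2 : 2%:R != 0 :> F by rewrite pnatr_eq0.
have -> : A N f - A N (2%:R^-1 *: (A m f + A n f))
  = 2%:R^-1 *: ((A N f - A N (A m f)) + (A N f - A N (A n f))).
  rewrite [A N (_ *: _)]linearZ /= [A N (_ + _)]linearD /=.
  rewrite addrACA -opprD scalerBr; congr (_ - _).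
  by rewrite -mulr2n -(scaler_nat 2 (A N f)) scalerA mulVf // scale1r.
rewrite (nrm_invn nrmP) ler_pdivrMl //.
apply: le_trans (nrmD nrmP _ _) _.
have := avg_avg N f m0; have := avg_avg N f n0.
set b := N%:R^-1 * _ => hn hm.
have b0 : 0 <= b by rewrite !mulr_ge0 ?invr_ge0 // (nrm_ge0 nrmP).
have : n%:R * b <= m%:R * b by rewrite ler_wpM2r // ler_nat.
lra.
Qed.

(** Both A_m f and A_n f have almost no more energy than A_x f, their midpoint
loses eps^2/4 on that by the parallelogram law, and A_N f has almost no more
energy than the midpoint. The two comparisons cost
(8/L) |f|^2 each. *)
Lemma energy_decrement L x n m N f eps : (0 < x)%N -> (0 < L)%N ->
  (L * x <= n)%N -> (n <= m)%N -> (L * m <= N)%N ->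
  0 < eps -> eps < nrm (A m f - A n f) ->
  nrm (A N f) ^+ 2 <=
    nrm (A x f) ^+ 2 + 16 / L%:R * nrm f ^+ 2 - eps ^+ 2 / 4.
Proof.
move=> x0 L0 xn nm mN e0 he.
have n0 : (0 < n)%N by nia.
have nm0 : (0 < n <= m)%N by rewrite n0.
have hmid := energy_midpoint f nm0 L0 mN.
have hn := @energy_mono L x n f x0 L0 xn.
have hm := @energy_mono L x m f x0 L0 (leq_trans xn nm).
have hp := nrm_parallelogram nrmP (A m f) (A n f).
have e2 : eps ^+ 2 <= nrm (A m f - A n f) ^+ 2.
  by rewrite lerXn2r ?nnegrE ?(ltW e0) ?(ltW he) ?(nrm_ge0 nrmP).
rewrite (nrm_invn nrmP) exprMn in hmid.
have e4 : (2%:R^-1 : R) ^+ 2 = 1 / 4 by field.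
rewrite e4 in hmid.
by lra.
Qed.

End NonexpansiveAverages.

(** * The search for a stable window *)

(** The first factor 128 rho^2 separates the window [L n, K(L n)] from the scale
n below it, the second separates it from the next scale. *)
Definition search_step (K : nat -> nat) (rho n : nat) : nat :=
  (128 * rho ^ 2 * K (128 * rho ^ 2 * n))%N.

Lemma search_step_ge K rho x : (forall n, (n <= K n)%N) -> (0 < rho)%N ->
  (x <= search_step K rho x)%N.
Proof.
move=> K_ge rho0; have := K_ge (128 * rho ^ 2 * x)%N.
have : (0 < rho ^ 2)%N by rewrite expn_gt0 rho0.
by rewrite /search_step; set k := K _; set q := (rho ^ 2)%N; nia.
Qed.

Section Search.
Variables (R : realType) (F : numFieldType) (V : lmodType F) (nrm : V -> R).
Variables (nrmP : euclidean_norm nrm) (T : {linear V -> V}).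
Hypothesis T_nonexp : nonexpansive nrm T.
Variables (K : nat -> nat) (f : V) (eps : R).
Hypothesis K_ge : forall n, (n <= K n)%N.
Hypotheses (f_neq0 : f != 0) (eps_gt0 : 0 < eps).

Local Notation A := (ergodic_avg T).
Local Notation rho := (norm_ratio nrm f eps).
Local Notation L := (128 * rho ^ 2)%N.
Local Notation step := (search_step K rho).

Lemma norm_ratio_ge : nrm f <= rho%:R * eps.
Proof.
have c0 : 0 <= Num.ceil (nrm f / eps).
  have q0 : 0 <= nrm f / eps := divr_ge0 (nrm_ge0 nrmP _) (ltW eps_gt0).
  by rewrite ceil_ge0 (lt_le_trans _ q0) ?ltrN10.
rewrite -ler_pdivrMr //; apply: le_trans (ceil_ge _) _.
by rewrite /norm_ratio -[X in X%:~R <= _](gez0_abs c0).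
Qed.

Lemma norm_ratio_gt0 : (0 < rho)%N.
Proof.
rewrite lt0n; apply: contra_neq f_neq0 => rho0; apply: (nrm_eq0 nrmP).
have := norm_ratio_ge; rewrite rho0 mul0r => h.
by apply/eqP; rewrite eq_le h (nrm_ge0 nrmP).
Qed.

Lemma norm_ratio_sqr_ge : nrm f ^+ 2 <= rho%:R ^+ 2 * eps ^+ 2.
Proof.
rewrite -exprMn lerXn2r ?nnegrE ?(nrm_ge0 nrmP) ?norm_ratio_ge //.
by rewrite mulr_ge0 ?ler0n ?(ltW eps_gt0).
Qed.

Let step_ge n : (n <= step n)%N.
Proof. exact: search_step_ge K_ge norm_ratio_gt0. Qed.

(** Each unstable window costs eps^2/4, of which L = 128 rho^2 lets the error
16/L |f|^2 take back at most eps^2/8. *)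
Lemma energy_search s j : (0 < s)%N ->
  (forall i, (i < j)%N ->
     ~ stable_from nrm K T f eps (L * iter i step s)) ->
  nrm (A (iter j step s) f) ^+ 2 <=
    nrm f ^+ 2 - j%:R * (eps ^+ 2 / 8).
Proof.
move=> s0; have rho0 := norm_ratio_gt0.
have L0 : (0 < L)%N by rewrite muln_gt0 expn_gt0 rho0.
elim: j => [|j IHj] hj.
  rewrite mul0r subr0 lerXn2r ?nnegrE ?(nrm_ge0 nrmP) //.
  exact: nrm_avg.
have {IHj} := IHj (fun i hi => hj i (ltnW hi)).
have := hj j (ltnSn j); rewrite iterS.
have : (0 < iter j step s)%N.
  by elim: (j) => //= i IHi; apply: leq_trans (step_ge _).
set x := iter j _ s => x0 unst hx.
have [m [/andP[xm mK] hm]] : exists m, (L * x <= m <= K (L * x))%N /\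
    eps < nrm (A m f - A (L * x)%N f).
  apply: contrapT => none; apply: unst; split; first by rewrite muln_gt0 L0.
  move=> m hm; rewrite leNgt; apply/negP => lt_eps.
  by apply: none; exists m.
have N_ge : (L * m <= step x)%N by rewrite leq_mul2l mK orbT.
have := energy_decrement nrmP T_nonexp x0 L0 (leqnn _) xm N_ge eps_gt0 hm.
have f2 : 16 / L%:R * nrm f ^+ 2 <= eps ^+ 2 / 8.
  have r0 : 0 < rho%:R :> R by rewrite ltr0n.
  have h := norm_ratio_sqr_ge.
  rewrite natrM natrX mulrAC ler_pdivrMr; last by rewrite mulr_gt0 ?exprn_gt0.
  have -> : eps ^+ 2 / 8 * (128 * rho%:R ^+ 2) = 16 * (rho%:R ^+ 2 * eps ^+ 2).
    by field.
  lra.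
by rewrite -natr1 mulrDl mul1r; lra.
Qed.

Lemma stability_rate_search s : (0 < s)%N ->
  exists r, is_stability_rate nrm K T f eps r /\
    (r <= iter (8 * rho ^ 2).+1 step s)%N.
Proof.
move=> s0; set J := (8 * rho ^ 2).+1.
have [i [i_lt st]] : exists i, (i < J)%N /\
    stable_from nrm K T f eps (L * iter i step s).
  apply: contrapT => none.
  have unst i : (i < J)%N -> ~ stable_from nrm K T f eps (L * iter i step s).
    by move=> hi st; apply: none; exists i.
  have := energy_search s0 unst.
  have := norm_ratio_sqr_ge.
  rewrite /J -natr1 natrM natrX mulrDl => h1 h2.
  have := exprn_ge0 2 (nrm_ge0 nrmP (A (iter (8 * rho ^ 2).+1 step s) f)).
  have : 0 < eps ^+ 2 by rewrite exprn_gt0.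
  lra.
have ex : exists n, `[< stable_from nrm K T f eps n >].
  by exists (L * iter i step s)%N; apply/asboolP.
have [r /asboolP hr min_r] := ex_minnP ex.
exists r; split; first by split=> // n /asboolP/min_r.
apply: leq_trans (min_r _ (asboolT st)) _.
apply: (@leq_trans (iter i.+1 step s)).
  rewrite iterS /search_step leq_mul2l; apply/orP; right.
  apply: leq_trans (K_ge _); rewrite leq_pmull // muln_gt0 expn_gt0.
  by rewrite norm_ratio_gt0.
rewrite -(subnK i_lt) iterD; elim: (J - _)%N => //= k IHk.
exact: leq_trans (step_ge _).
Qed.

End Search.

(** * Real and complex Hilbert norms *)

Section HilbertNorms.
Variable R : realType.

Lemma hilbert_parallelogram (F : numFieldType) (theta : F -> F)
    (H : hilbertSpace theta) (u v : H) :
  `|u + v| ^+ 2 + `|u - v| ^+ 2 = 2 * `|u| ^+ 2 + 2 * `|v| ^+ 2.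
Proof.
rewrite !inner_normE linearBl !linearBr linearDl !linearDr /=.
by ring.
Qed.

Lemma real_norm_euclidean (H : realHilbert R) : euclidean_norm (@real_norm R H).
Proof.
split; rewrite /real_norm.
- by move=> u; exact: normr_ge0.
- by move=> u /normr0_eq0.
- by move=> u v; exact: ler_normD.
- by move=> n u; rewrite normrZ ger0_norm ?invr_ge0.
- exact: hilbert_parallelogram.
Qed.

Lemma complex_normE (H : complexHilbert R) (u : H) :
  (complex_norm u)%:C%C = `|u|.
Proof. by rewrite /complex_norm RRe_real // ger0_real. Qed.

Lemma complex_norm_euclidean (H : complexHilbert R) :
  euclidean_norm (@complex_norm R H).
Proof.
split.
- by move=> u; rewrite -lecR complex_normE; exact: normr_ge0.
- by move=> u u0; apply: normr0_eq0; rewrite -complex_normE u0.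
- by move=> u v; rewrite -lecR rmorphD /= !complex_normE; exact: ler_normD.
- move=> n u; apply: complexI; rewrite rmorphM fmorphV rmorph_nat /=.
  by rewrite !complex_normE normrZ ger0_norm ?invr_ge0.
- move=> u v; apply: complexI.
  rewrite !(rmorphD, rmorphM, rmorphXn, rmorph_nat) /= !complex_normE.
  exact: hilbert_parallelogram.
Qed.

(** Reduces a rate to an estimate on natural numbers: the search is started at
rho, which is legitimate because any positive starting point will do. *)
Lemma uniform_rate_search (K : nat -> nat)
    (P : forall V : Type, (V -> R) -> (V -> V) -> Prop)
    (B : R -> nat -> nat -> Prop) (C : R) (rho0 : nat) :
  (forall n, (n <= K n)%N) -> 0 < C ->
  (forall (V : Type) (nrm : V -> R) T, P V nrm T -> nonexpansive nrm T) ->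
  (forall rho r, (rho0 <= rho)%N -> (0 < rho)%N ->
     (r <= iter (8 * rho ^ 2).+1 (search_step K rho) rho)%N -> B C rho r) ->
  uniform_rate K P B.
Proof.
move=> K_ge C0 P_nonexp hB; exists C, rho0; split=> //.
have main (F : numFieldType) (V : lmodType F) (nrm : V -> R)
    (T : {linear V -> V}) :
    euclidean_norm nrm -> P V nrm T -> rate_bounded nrm K T (B C) rho0.
  move=> nrmP /P_nonexp T_nonexp f eps f0 eps0.
  have rho_gt0 := norm_ratio_gt0 nrmP f0 eps0.
  have [r [r_rate r_le]] :=
    stability_rate_search nrmP T_nonexp K_ge f0 eps0 rho_gt0.
  by exists r; split=> // rho_ge; apply: hB.
by split=> H T; apply: main; [exact: real_norm_euclidean|
  exact: complex_norm_euclidean].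
Qed.

End HilbertNorms.

(** * Growth of the search *)

(** Domination of h by g, known only from a onwards, passes to the iterates
because those of h never leave that range. *)
Lemma leq_iter (h g : nat -> nat) (a j : nat) :
  (forall x, (a <= x)%N -> (x <= h x)%N) ->
  (forall x, (a <= x)%N -> (h x <= g x)%N) ->
  {homo g : x y / (x <= y)%N} ->
  (iter j h a <= iter j g a)%N.
Proof.
move=> h_ge h_le g_homo.
have ge_a i : (a <= iter i h a)%N.
  by elim: i => //= i IHi; apply: leq_trans (h_ge _ IHi).
by elim: j => //= j IHj; apply: leq_trans (h_le _ (ge_a _)) (g_homo _ _ IHj).
Qed.

Lemma lacunarity_le rho x : (128 <= rho <= x)%N -> (128 * rho ^ 2 <= x ^ 3)%N.
Proof.
move=> /andP[h1 h2]; rewrite [(x ^ 3)%N]expnS.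
by rewrite leq_mul ?leq_sqr // (leq_trans h1).
Qed.

Section SearchStepBounds.
Variables (K : nat -> nat) (c n0 rho x : nat).
Hypotheses (rho_ge128 : (128 <= rho)%N) (rho_ge_n0 : (n0 <= rho)%N).
Hypotheses (rho_ge_c : (c <= rho)%N) (x_ge : (rho <= x)%N).

Local Notation L := (128 * rho ^ 2)%N.

Let L_le : (L <= x ^ 3)%N.
Proof. by apply: lacunarity_le; rewrite rho_ge128. Qed.

Let Lx_le : (L * x <= x ^ 4)%N.
Proof. by rewrite [(x ^ 4)%N]expnSr leq_mul. Qed.

Let Lx_ge : (n0 <= L * x)%N.
Proof.
apply: leq_trans (leq_trans rho_ge_n0 x_ge) _.
by rewrite leq_pmull // muln_gt0 expn_gt0 (leq_trans _ rho_ge128).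
Qed.

Lemma search_step_poly : (forall n, (n0 <= n)%N -> (K n <= n ^ c)%N) ->
  (search_step K rho x <= x ^ (3 + 4 * c))%N.
Proof.
move=> hK; rewrite /search_step expnD expnM leq_mul //.
rewrite (leq_trans (hK _ Lx_ge)) //.
by case: (c) => // e; rewrite leq_exp2r.
Qed.

(** The exponents 3x + x^5 <= x^6 are polynomial in x, and two more exponentials
absorb any fixed power: x^6 <= 2^(6x), then 6x <= 2^(2x) and 2x <= 2^x. *)
Lemma search_step_exp : (forall n, (n0 <= n)%N -> (K n <= 2 ^ (c * n))%N) ->
  (search_step K rho x <= iter_exp2 x 4)%N.
Proof.
move=> hK; have x128 : (128 <= x)%N by exact: leq_trans x_ge.
have pow2 y : (y <= 2 ^ y)%N by apply: ltnW; exact: ltn_expl.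
have c_x : (c <= x)%N by exact: leq_trans x_ge.
have step1 : (search_step K rho x <= 2 ^ (3 * x + x ^ 5))%N.
  rewrite /search_step expnD leq_mul //.
    by apply: leq_trans L_le _; rewrite mulnC expnM leq_exp2r.
  apply: leq_trans (hK _ Lx_ge) _.
  by rewrite leq_exp2l // [(x ^ 5)%N]expnS leq_mul.
apply: leq_trans step1 _; rewrite /iter_exp2 /= leq_exp2l //.
have step2 : (3 * x + x ^ 5 <= x ^ 6)%N.
  have h2 : (x <= x ^ 5)%N.
    by rewrite -{1}(expn1 x) leq_pexp2l // (leq_trans _ x128).
  by rewrite [(x ^ 6)%N]expnS; set y := (x ^ 5)%N in h2 *; nia.
apply: leq_trans step2 _.
have step3 : (x ^ 6 <= 2 ^ (x * 6))%N by rewrite expnM leq_exp2r.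
apply: leq_trans step3 _; rewrite leq_exp2l //.
have step4 : (x * 6 <= 2 ^ (x * 2))%N.
  rewrite muln2 -addnn expnD leq_mul // (leq_trans _ (pow2 x)) //.
  exact: leq_trans x128.
apply: leq_trans step4 _; rewrite leq_exp2l //.
have -> : x = x.-1.+1 by rewrite prednK // (leq_trans _ x128).
by rewrite expnS mulnC leq_mul // ltn_expl.
Qed.

Lemma search_step_linear : (forall n, (n0 <= n)%N -> (K n <= c * n)%N) ->
  (search_step K rho x <= rho ^ 7 * x)%N.
Proof.
move=> hK; rewrite /search_step.
have hL : (L <= rho ^ 3)%N by apply: lacunarity_le; rewrite rho_ge128 leqnn.
apply: (@leq_trans (rho ^ 3 * (rho * (rho ^ 3 * x)))%N); last first.
  by apply: eq_leq; ring.
by rewrite leq_mul // (leq_trans (hK _ Lx_ge)) // leq_mul // leq_mul.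
Qed.

End SearchStepBounds.

Section IteratedBounds.
Variables (K : nat -> nat) (c n0 rho : nat).
Hypothesis K_ge : forall n, (n <= K n)%N.
Hypotheses (rho_ge128 : (128 <= rho)%N) (rho_ge_n0 : (n0 <= rho)%N).
Hypothesis (rho_ge_c : (c <= rho)%N).

Local Notation J := (8 * rho ^ 2).+1.

Let rho_gt0 : (0 < rho)%N. Proof. exact: leq_trans rho_ge128. Qed.

Let rho_le_sqr : (rho <= rho ^ 2)%N. Proof. by rewrite leq_pmulr. Qed.

Let leq_iter_step (g : nat -> nat) (j : nat) :
  (forall x, (rho <= x)%N -> (search_step K rho x <= g x)%N) ->
  {homo g : x y / (x <= y)%N} ->
  (iter j (search_step K rho) rho <= iter j g rho)%N.
Proof. by apply: leq_iter => x _; exact: search_step_ge. Qed.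

(** The search stays below rho^(d^J) with d = 3 + 4c. As rho and d are at most
2^rho and 2^d, its logarithm is at most 2^(rho + d J). *)
Lemma search_poly : (forall n, (n0 <= n)%N -> (K n <= n ^ c)%N) ->
  (iter J (search_step K rho) rho
    <= 2 ^ (2 ^ ((9 * (3 + 4 * c)).+1 * rho ^ 2)))%N.
Proof.
move=> hK; set d := (3 + 4 * c)%N.
have d0 : (0 < d)%N by [].
apply: (@leq_trans (iter J (expn^~ d) rho)).
  apply: leq_iter_step => [x hx|x y xy]; last by rewrite leq_exp2r.
  exact: search_step_poly hK.
have -> j : iter j (expn^~ d) rho = (rho ^ (d ^ j))%N.
  by elim: j => // j IHj; rewrite iterS IHj -expnM expnSr.
apply: (@leq_trans ((2 ^ rho) ^ (d ^ J))%N).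
  by rewrite leq_exp2r ?expn_gt0 ?d0 //; apply: ltnW; exact: ltn_expl.
rewrite -expnM leq_exp2l //.
apply: (@leq_trans (2 ^ rho * (2 ^ d) ^ J)%N).
  by rewrite leq_mul ?leq_exp2r //; apply: ltnW; exact: ltn_expl.
rewrite -expnM -expnD leq_exp2l //.
by move: rho_le_sqr; set q := (rho ^ 2)%N; nia.
Qed.

(** Four exponentials per step make at most 36 rho^2, and starting from rho
instead of 1 costs at most rho more. *)
Lemma search_exp : (forall n, (n0 <= n)%N -> (K n <= 2 ^ (c * n))%N) ->
  (iter J (search_step K rho) rho <= iter_exp2 1 (37 * rho ^ 2))%N.
Proof.
move=> hK; have exp_homo k : {homo iter_exp2^~ k : x y / (x <= y)%N}.
  by elim: k => // k IHk x y /IHk; rewrite /iter_exp2 !iterS leq_exp2l.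
apply: (@leq_trans (iter J (iter_exp2^~ 4) rho)).
  apply: leq_iter_step; last exact: exp_homo.
  by move=> x hx; exact: search_step_exp hK.
have -> : iter J (iter_exp2^~ 4) rho = iter_exp2 rho (J * 4).
  by rewrite /iter_exp2 iterM.
have rho_le : (rho <= iter_exp2 1 rho)%N.
  elim: (rho) => // k IHk; rewrite /iter_exp2 iterS.
  by apply: leq_ltn_trans IHk _; exact: ltn_expl.
apply: leq_trans (exp_homo _ _ _ rho_le) _.
rewrite {1}/iter_exp2 -iterD -/(iter_exp2 1 _).
have exp_le m k : (m <= k)%N -> (iter_exp2 1 m <= iter_exp2 1 k)%N.
  move=> mk; rewrite -(subnK mk) /iter_exp2 iterD; elim: (k - m)%N => //= i IHi.
  by apply: leq_trans IHi _; apply: ltnW; exact: ltn_expl.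
apply: exp_le; move: rho_le_sqr rho_gt0; set q := (rho ^ 2)%N; lia.
Qed.

(** A factor rho^7 per step, and rho to start from: 7 J + 1 <= 64 rho^2. *)
Lemma search_linear : (forall n, (n0 <= n)%N -> (K n <= c * n)%N) ->
  (iter J (search_step K rho) rho <= rho ^ (64 * rho ^ 2))%N.
Proof.
move=> hK; apply: (@leq_trans (iter J (muln (rho ^ 7)) rho)).
  apply: leq_iter_step => [x hx|x y xy]; last by rewrite leq_mul2l xy orbT.
  exact: search_step_linear hK.
rewrite iter_muln -expnM -expnSr leq_exp2l ?(leq_trans _ rho_ge128) //.
move: rho_le_sqr (leq_trans rho_ge128 rho_le_sqr); set q := (rho ^ 2)%N; lia.
Qed.

End IteratedBounds.

(** * Comparison with the asymptotic bounds *)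

Section RealBounds.
Variable R : realType.

Lemma nat_upper (c : R) : exists k : nat, c <= k%:R.
Proof. by exists (Num.trunc c).+1; apply: ltW; exact: truncnS_gt. Qed.

Lemma poly_growth_nat (K : nat -> nat) :
  (exists c : R, \forall n \near \oo, (K n)%:R <= n%:R `^ c) ->
  exists c n0 : nat, forall n, (n0 <= n)%N -> (K n <= n ^ c)%N.
Proof.
move=> [c [n0 _ hK]]; have [k ck] := nat_upper c.
exists k, n0.+1 => n n0n; rewrite -(ler_nat R) natrX -powR_mulrn //.
apply: le_trans (hK n (ltnW n0n)) _; apply: ler_powR => //.
by rewrite ler1n (leq_trans _ n0n).
Qed.

Lemma exp_growth_nat (K : nat -> nat) :
  (exists c : R, \forall n \near \oo, (K n)%:R <= 2 `^ (c * n%:R)) ->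
  exists c n0 : nat, forall n, (n0 <= n)%N -> (K n <= 2 ^ (c * n))%N.
Proof.
move=> [c [n0 _ hK]]; have [k ck] := nat_upper c.
exists k, n0 => n n0n; rewrite -(ler_nat R) natrX -powR_mulrn //.
apply: le_trans (hK n n0n) _; apply: ler_powR; first by rewrite ler1n.
by rewrite natrM ler_wpM2r.
Qed.

Lemma linear_growth_nat (K : nat -> nat) :
  (exists c : R, \forall n \near \oo, (K n)%:R <= c * n%:R) ->
  exists c n0 : nat, forall n, (n0 <= n)%N -> (K n <= c * n)%N.
Proof.
move=> [c [n0 _ hK]]; have [k ck] := nat_upper c.
exists k, n0 => n n0n; rewrite -(ler_nat R) natrM.
by apply: le_trans (hK n n0n) _; rewrite ler_wpM2r.
Qed.

Lemma double_exp_bound_nat (a rho r : nat) : 1 <= ln (ln rho%:R) :> R ->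
  (r <= 2 ^ (2 ^ (a * rho ^ 2)))%N -> double_exp_bound (a%:R : R) rho r.
Proof.
move=> lnln_ge r_le; rewrite /double_exp_bound.
apply: (@le_trans _ _ (2 `^ (2 `^ (a * rho ^ 2)%:R))).
  rewrite powR_mulrn // -natrX powR_mulrn // -natrX ler_nat.
  exact: r_le.
by rewrite ler_powR ?ler1n // ler_powR ?ler1n // natrM natrX ler_peMr.
Qed.

(** The division by ln 2 converts the power of rho into a power of 2. *)
Lemma exp_bound_nat (a rho r : nat) : (0 < rho)%N ->
  (r <= rho ^ (a * rho ^ 2))%N -> exp_bound (a%:R / ln 2 : R) rho r.
Proof.
move=> rho0 r_le; rewrite /exp_bound.
have ln2 : 0 < ln 2 :> R by rewrite ln_gt0 // ltr1n.
have -> : a%:R / ln 2 * rho%:R ^+ 2 * ln rho%:R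
    = (a * rho ^ 2)%:R * ln rho%:R / ln 2 :> R.
  by rewrite natrM natrX; field; rewrite gt_eqF.
rewrite /powR pnatr_eq0 /= divfK ?gt_eqF //.
by rewrite expRM_natl lnK ?posrE ?ltr0n // -natrX ler_nat.
Qed.

End RealBounds.

Theorem theorem2p17 (R : realType) (K : nat -> nat)
  (K_nondecreasing : {homo K : m n / (m <= n)%N})
  (K_ge : forall n : nat, (n <= K n)%N) :
  [/\ (exists c : R, \forall n \near \oo, (K n)%:R <= n%:R `^ c) ->
        uniform_rate K (@nonexpansive R) (@double_exp_bound R),
      (exists c : R, \forall n \near \oo, (K n)%:R <= 2 `^ (c * n%:R)) ->
        uniform_rate K (@nonexpansive R) (@tower_bound R)
    & (exists c : R, \forall n \near \oo, (K n)%:R <= c * n%:R) ->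
        uniform_rate K (@norm_preserving R) (@exp_bound R)].
Proof.
split.
- move=> /poly_growth_nat[c [n0 hK]].
  (* rho >= e^e makes ln (ln rho) at least 1, so that this factor of the bound
     can only help. *)
  have [k k_ge] := nat_upper (expR (expR 1) : R).
  apply: (@uniform_rate_search _ _ _ _ (9 * (3 + 4 * c)).+1%:R
    (maxn (maxn 128 k) (maxn n0 c))) => // rho r.
  rewrite !geq_max => /andP[/andP[h128 hk] /andP[hn0 hc]] rho0 r_le.
  apply: double_exp_bound_nat; last exact: leq_trans (search_poly _ _ _ _ hK).
  have rho_ge : expR (expR 1) <= rho%:R :> R.
    by apply: le_trans k_ge _; rewrite ler_nat.
  have ln_ge : expR 1 <= ln rho%:R :> R.
    by rewrite -[leLHS]expRK ler_ln ?posrE ?expR_gt0 // ltr0n.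
  rewrite -[leLHS]expRK ler_ln ?posrE ?expR_gt0 //.
  by rewrite (lt_le_trans _ ln_ge) ?expR_gt0.
- move=> /exp_growth_nat[c [n0 hK]].
  apply: (@uniform_rate_search _ _ _ _ 37 (maxn 128 (maxn n0 c))) => // rho r.
  rewrite !geq_max => /andP[h128 /andP[hn0 hc]] rho0 r_le.
  rewrite /tower_bound -natrX -natrM pmulrn intrKceil.
  exact: leq_trans (search_exp _ _ _ _ hK).
- move=> /linear_growth_nat[c [n0 hK]].
  apply: (@uniform_rate_search _ _ _ _ (64%:R / ln 2)
    (maxn 128 (maxn n0 c))) => //.
  + by rewrite divr_gt0 // ln_gt0 // ltr1n.
  + by move=> V nrm T T_isom f; rewrite T_isom.
  move=> rho r; rewrite !geq_max => /andP[h128 /andP[hn0 hc]] rho0 r_le.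
  by apply: exp_bound_nat => //; exact: leq_trans (search_linear _ _ _ _ hK).
Qed.
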